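(* Let $(X,d)$ be a complete CAT$(0)$ space and let $A,B\subseteq X$ be nonempty, closed and convex. Suppose that $S:=\{(a,b)\in A\times B: d(a,b)=\mathrm{dist}(A,B)\}\neq\emptyset$. Let $(\varepsilon_n)$ and $(\delta_n)$ be sequences of nonnegative reals with $\sum_{n=0}^\infty\varepsilon_n<\infty$ and $\sum_{n=0}^\infty\delta_n<\infty$. Given $x_0\in X$, let $(x_n)$ (starting at $x_0$) and $(y_n)$ be any sequences in $X$ satisfying $$d(y_n,P_Bx_n)\le\varepsilon_n\quad\text{and}\quad d(x_{n+1},P_Ay_n)\le\delta_n\quad\text{for each }n\in\mathbb{N}.$$ Then there exists $(a,b)\in S$ such that $(x_n)$ and $(y_n)$ $\Delta$-converge to $a$ and $b$, respectively. If, in addition, $A$ or $B$ is locally compact, then the convergence is strong (i.e. in the metric $d$).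
   Context: $\mathbb{N}=\{0,1,2,\ldots\}$. A CAT$(0)$ space is a geodesic space of nonpositive curvature in the sense of Alexandrov. A subset is convex iff it contains all geodesic segments joining any two of its points. $\mathrm{dist}(A,B)=\inf\{d(a,b):a\in A,b\in B\}$. For $C$ nonempty closed convex in a complete CAT$(0)$ space, the metric projection $P_C(x)$ is the unique point $c\in C$ with $d(x,c)=\inf_{c'\in C}d(x,c')$. For a bounded sequence $(x_n)$ in $X$, an asymptotic center is a point $x\in X$ with $\limsup_n d(x,x_n)=\inf_{y\in X}\limsup_n d(y,x_n)$. A bounded sequence $(x_n)$ $\Delta$-converges to $x\in X$ iff $x$ is the unique asymptotic center of every subsequence of $(x_n)$. *)

(* Defs.v *)
From HB Require Import structures.
From mathcomp Require Import all_boot all_order all_algebra.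
From mathcomp Require Import all_classical all_reals all_analysis.

Set Implicit Arguments.
Unset Strict Implicit.
Unset Printing Implicit Defensive.

Import Order.TTheory GRing.Theory Num.Theory.
Import numFieldNormedType.Exports.

Local Open Scope classical_set_scope.
Local Open Scope ring_scope.

(* The Euclidean plane is coordinatised by hand because the library norms on
   R * R and 'rV[R]_2 are sup norms. *)
Section EuclideanPlane.
Context {R : realType}.

Definition plane_dist (p q : R * R) : R :=
  Num.sqrt ((p.1 - q.1) ^+ 2 + (p.2 - q.2) ^+ 2).

Definition plane_segment (p q : R * R) : set (R * R) :=
  [set ((1 - t) * p.1 + t * q.1, (1 - t) * p.2 + t * q.2) | t in `[0, 1]].

End EuclideanPlane.

Section Cat0.
Context {R : realType} {X : metricType R}.
Implicit Types (x y z p q r : X) (A B C S : set X) (u v : nat -> X).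

Definition geodesic_path x y (c : R -> X) : Prop :=
  [/\ c 0 = x, c (mdist x y) = y &
      {in `[0, mdist x y] &, forall s t, mdist (c s) (c t) = `|s - t|}].

Definition geodesic_segment x y S : Prop :=
  exists2 c, geodesic_path x y c & S = c @` `[0, mdist x y].

Definition comparison_triangle p q r (p' q' r' : R * R) : Prop :=
  [/\ plane_dist p' q' = mdist p q,
      plane_dist q' r' = mdist q r &
      plane_dist r' p' = mdist r p].

(* [z'] is the comparison point in the Euclidean side [p', q'] of the point [z]
   of the geodesic side [S] joining [p] to [q]. *)
Definition comparison_point p q S (p' q' : R * R) z (z' : R * R) : Prop :=
  [/\ S z, plane_segment p' q' z' & plane_dist p' z' = mdist p z].

Definition triangle_comparison_point p q r Spq Sqr Srp (p' q' r' : R * R)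
    z (z' : R * R) : Prop :=
  [\/ comparison_point p q Spq p' q' z z',
      comparison_point q r Sqr q' r' z z' |
      comparison_point r p Srp r' p' z z'].

Definition convex_subset C : Prop :=
  forall x y S, C x -> C y -> geodesic_segment x y S -> S `<=` C.

Definition set_dist A B : R := inf [set mdist a b | a in A & b in B].

Definition best_pairs A B : set (X * X) :=
  [set ab | [/\ A ab.1, B ab.2 & mdist ab.1 ab.2 = set_dist A B]].

Definition is_projection C x c : Prop :=
  C c /\ mdist x c = inf [set mdist x c' | c' in C].

(* The value is [x] itself when no nearest point exists; this does not happen
   for nonempty closed convex sets in complete CAT(0) spaces, where moreover the
   nearest point is unique. *)
Definition metric_proj C x : X := xget x [set c | is_projection C x c].

Definition bounded_seq u : Prop :=
  exists c, exists M : R, forall n, mdist c (u n) <= M.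

(* [limn_sup] and [inf] are real-valued and meaningful for bounded [u] only. *)
Definition asymptotic_radius_at u y : R := limn_sup (fun n => mdist y (u n)).

Definition asymptotic_center u x : Prop :=
  asymptotic_radius_at u x = inf (range (asymptotic_radius_at u)).

Definition delta_cvg u x : Prop :=
  bounded_seq u /\
  forall s : nat -> nat, {homo s : m n / (m < n)%N} ->
    asymptotic_center (u \o s) x /\
    forall y, asymptotic_center (u \o s) y -> y = x.

End Cat0.

Definition geodesic_space (R : realType) (X : metricType R) : Prop :=
  forall x y : X, exists c, geodesic_path x y c.

Definition cat0_space (R : realType) (X : metricType R) : Prop :=
  geodesic_space X /\
  forall (p q r : X) (Spq Sqr Srp : set X) (p' q' r' : R * R),
    geodesic_segment p q Spq -> geodesic_segment q r Sqr ->
    geodesic_segment r p Srp -> comparison_triangle p q r p' q' r' ->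
  forall (x y : X) (x' y' : R * R),
    triangle_comparison_point p q r Spq Sqr Srp p' q' r' x x' ->
    triangle_comparison_point p q r Spq Sqr Srp p' q' r' y y' ->
    mdist x y <= plane_dist x' y'.

(* The library's [completeType] is pointed, whereas [metricType] is not. *)
Definition complete_metric (R : realType) (X : metricType R) : Prop :=
  forall u : nat -> X, cauchy (u @ \oo) -> exists l : X, u @ \oo --> l.

(* Main.v *)
Require Import Defs.
From HB Require Import structures.
From mathcomp Require Import all_boot all_order all_algebra.
From mathcomp Require Import all_classical all_reals all_analysis.
From mathcomp Require Import ring lra.

(* The comparison inequality yields the (CN) inequality of Bruhat and Tits, which
   makes both distance functions and asymptotic radii uniformly convex; hence
   projections onto closed convex sets and asymptotic centers exist and are
   unique. It also makes a projection [P] nonexpansive, and if [d(P x, P a)] is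
   nearly [d(x, a)] then [d(x, P x)] is at most slightly larger than
   [d(a, P a)].

   For [(a, b)] in [S], the distances [d(a, x_n)] decrease up to summable errors,
   so they converge, and [d(b, y_n)] has the same limit. The near equality case
   above gives [d(x_n, P_B x_n) --> dist(A, B)], whence
   [d(x_n, P_A (P_B x_n)) --> 0]. The asymptotic center of any subsequence of
   [x] is therefore a fixed point of [P_A \o P_B], that is, the first component of
   a pair in [S]. Since [d(c, x_n)] converges for every such point [c], all
   subsequences have the same center. The sequence [y] is handled by exchanging
   [A] and [B], the pair [(x, y)] becoming [(y, x_{.+1})]. *)

Import Order.TTheory GRing.Theory Num.Theory.
Import numFieldNormedType.Exports.

Local Open Scope classical_set_scope.
Local Open Scope ring_scope.

(** * Real sequences: summable errors, subsequences and upper limits *)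

Section RealSequences.
Context {R : realType}.
Implicit Types (v g : nat -> R) (s : nat -> nat).

Lemma series_nondecreasing g :
  (forall n, 0 <= g n) -> nondecreasing_seq (series g).
Proof.
move=> g0; apply/nondecreasing_seqP => n.
by rewrite /series /= big_nat_recr//= lerDl.
Qed.

(** Subtracting the partial sums of [g] leaves a nonincreasing sequence, bounded below by minus the
    sum of [g]. *)
Lemma cvgn_almost_nonincreasing v g :
  (forall n, 0 <= v n) -> (forall n, 0 <= g n) -> cvgn (series g) ->
  (forall n, v n.+1 <= v n + g n) -> cvgn v.
Proof.
move=> v0 g0 cg vS.
have ndg := series_nondecreasing _ g0.
have : cvgn (v - series g).
  apply: nonincreasing_is_cvgn.
    apply/nonincreasing_seqP => n; rewrite !fctE /series /= big_nat_recr//=.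
    by have := vS n; lra.
  exists (- limn (series g)) => _ [n _ <-]; rewrite !fctE.
  by have := nondecreasing_cvgn_le ndg cg n; have := v0 n; lra.
move=> cw; have -> : v = (v - series g) + series g.
  by apply/funext => n; rewrite !fctE subrK.
exact: is_cvgD.
Qed.

Lemma cvgn_series_lty g :
  (forall n, 0 <= g n) -> (\sum_(0 <= n <oo) (g n)%:E < +oo)%E ->
  cvgn (series g).
Proof.
move=> g0 gy; apply: nondecreasing_is_cvgn; first exact: series_nondecreasing.
have S0 : (0 <= \sum_(0 <= n <oo) (g n)%:E)%E.
  by apply: nneseries_ge0 => n _ _; rewrite lee_fin.
exists (fine (\sum_(0 <= n <oo) (g n)%:E)) => _ [n _ <-].
rewrite -lee_fin fineK ?ge0_fin_numE// /series /= -sumEFin.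
by apply: nneseries_lim_ge => k _ _; rewrite lee_fin.
Qed.

(** Exchanging [A] and [B] replaces [eps] by its shift, which must still be summable. *)
Lemma cvgn_series_shift1 g :
  (forall n, 0 <= g n) -> cvgn (series g) -> cvgn (series (fun n => g n.+1)).
Proof.
move=> g0 cg.
have ndg := series_nondecreasing _ g0.
apply: nondecreasing_is_cvgn; first exact: series_nondecreasing.
exists (limn (series g)) => _ [n _ <-].
apply: le_trans (nondecreasing_cvgn_le ndg cg n.+1).
by rewrite /series /= big_nat_recl//= lerDr.
Qed.

Lemma leq_strict_mono s : {homo s : m n / (m < n)%N} -> forall n, (n <= s n)%N.
Proof.
by move=> sS; elim=> // n /leq_ltn_trans; apply; exact: sS.
Qed.

Lemma near_strict_mono s (P : set nat) : {homo s : m n / (m < n)%N} ->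
  (\forall n \near \oo, P n) -> \forall n \near \oo, P (s n).
Proof.
move=> sS [N _ NP]; exists N => // n /= Nn; apply: NP => /=.
exact: leq_trans Nn (leq_strict_mono _ sS n).
Qed.

Lemma frequently_subseq (P : set nat) :
  (forall N, exists2 n, (N <= n)%N & P n) ->
  exists2 s : nat -> nat, {homo s : m n / (m < n)%N} & forall n, P (s n).
Proof.
move=> HP; have [f fP] := choice (fun N => let: ex_intro2 n a b := HP N in
  ex_intro (fun n => (N <= n)%N /\ P n) n (conj a b)).
pose s := fix s n := if n is k.+1 then f (s k).+1 else f 0%N.
exists s; last first.
  by case=> [|n]; [have [] := fP 0%N | have [] := fP (s n).+1].
have sS n : (s n < s n.+1)%N by have [] := fP (s n).+1.
exact: homo_ltn ltn_trans sS.
Qed.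

Lemma limn_sup_lt v (M c : R) : (forall n, 0 <= v n <= M) -> limn_sup v < c ->
  \forall n \near \oo, v n < c.
Proof.
move=> vM.
have ub : has_ubound (range v) by exists M => _ [n _ <-]; case/andP: (vM n).
have lb : has_lbound (range v) by exists 0 => _ [n _ <-]; case/andP: (vM n).
have := cvg_sups_inf ub lb => /cvgP cs vc.
have [N _ Nc] := cvgr_lt _ cs _ vc; exists N => // n /Nc; apply: le_lt_trans.
apply: ub_le_sup; last by exists n => /=.
by exists M => _ [k _ <-]; case/andP: (vM k).
Qed.

Lemma limn_sup_le v (M c : R) : (forall n, 0 <= v n <= M) ->
  (\forall n \near \oo, v n <= c) -> limn_sup v <= c.
Proof.
move=> vM vc.
have ub : has_ubound (range v) by exists M => _ [n _ <-]; case/andP: (vM n).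
have lb : has_lbound (range v) by exists 0 => _ [n _ <-]; case/andP: (vM n).
have := cvg_sups_inf ub lb => /cvgP cs.
apply: limr_le => //; case: vc => N _ Nc; exists N => // n /= Nn.
apply: ge_sup; first by exists (v n), n => /=.
by move=> _ [k /= nk <-]; apply: Nc => /=; exact: leq_trans nk.
Qed.

End RealSequences.

(** * From comparison triangles to the (CN) inequality *)

Section Cat0Geometry.
Context {R : realType} {X : metricType R}.
Implicit Types (x y z p q m : X) (C : set X).

Lemma geodesic_path_segment x y (c : R -> X) : geodesic_path x y c ->
  geodesic_segment x y (c @` `[0, mdist x y]).
Proof. by exists c. Qed.

(** With one side on the axis the apex has explicit coordinates, and the formula in [t] is Stewart's
    theorem. *)
Lemma comparison_triangle_on_axis (x y z : X) : 0 < mdist x y ->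
  exists2 r : R * R, comparison_triangle x y z (0, 0) (mdist x y, 0) r &
    forall t, plane_dist r (t * mdist x y, 0) ^+ 2 =
      (1 - t) * mdist z x ^+ 2 + t * mdist z y ^+ 2
        - t * (1 - t) * mdist x y ^+ 2.
Proof.
have := metric_triangle x y z; have := metric_triangle y x z.
have := metric_triangle x z y; rewrite (metric_sym y z) (metric_sym x z).
rewrite (metric_sym y x).
have := mdist_ge0 z x; have := mdist_ge0 z y.
set a := mdist z y; set b := mdist z x; set c := mdist x y.
move=> a0 b0 cab abc bca c0.
(* The abscissa of the apex, from the law of cosines. By the triangle inequalities it is at most [b]
   in absolute value, so the ordinate is a genuine square root. *)
pose u := (b ^+ 2 + c ^+ 2 - a ^+ 2) / (2 * c).
have uE : 2 * c * u = b ^+ 2 + c ^+ 2 - a ^+ 2 by rewrite /u; field; lra.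
have ub : u ^+ 2 <= b ^+ 2.
  have u1 : u <= b by rewrite -(ler_pM2l (_ : 0 < 2 * c)) ?uE; nra.
  have u2 : - b <= u by rewrite -(ler_pM2l (_ : 0 < 2 * c)) ?uE; nra.
  nra.
have hE : Num.sqrt (b ^+ 2 - u ^+ 2) ^+ 2 = b ^+ 2 - u ^+ 2.
  by rewrite sqr_sqrtr// subr_ge0.
have sE (d e : R) : 0 <= e -> d = e ^+ 2 -> Num.sqrt d = e.
  by move=> e0 ->; rewrite sqrtr_sqr ger0_norm.
exists (u, Num.sqrt (b ^+ 2 - u ^+ 2)); last first.
  move=> t; rewrite /plane_dist /= subr0 hE sqr_sqrtr.
    by have := congr1 ( *%R t) uE; lra.
  by rewrite addr_ge0 ?sqr_ge0// subr_ge0.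
split; rewrite /plane_dist /=.
- by apply: (sE _ c); [lra|ring].
- rewrite (metric_sym y z); apply: (sE _ a) => //.
  by rewrite sub0r sqrrN hE; lra.
- by apply: (sE _ b) => //; rewrite !subr0 hE; ring.
Qed.

(* The inequality satisfied by [m] is the (CN) inequality of Bruhat and Tits
   for the point dividing the geodesic from [x] to [y] in the ratio [t]. *)
Lemma cat0_geodesic_point : cat0_space X -> forall x y (t : R), 0 <= t <= 1 ->
  exists m, [/\ mdist x m = t * mdist x y, mdist m y = (1 - t) * mdist x y,
    forall C, convex_subset C -> C x -> C y -> C m &
    forall z, mdist z m ^+ 2 <= (1 - t) * mdist z x ^+ 2 + t * mdist z y ^+ 2
        - t * (1 - t) * mdist x y ^+ 2].
Proof.
move=> [geo cmp] x y t /andP[t0 t1].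
have d0 := mdist_ge0 x y.
have [c gc] := geo x y; have [c0 c1 cd] := gc.
have I0 : 0 \in `[0, mdist x y] by rewrite in_itv /= lexx d0.
have I1 : mdist x y \in `[0, mdist x y] by rewrite in_itv /= lexx d0.
have It : t * mdist x y \in `[0, mdist x y].
  by rewrite in_itv /= mulr_ge0//= ler_piMl.
exists (c (t * mdist x y)).
have xm : mdist x (c (t * mdist x y)) = t * mdist x y.
  by rewrite -{1}c0 cd// sub0r normrN ger0_norm// mulr_ge0.
have my : mdist (c (t * mdist x y)) y = (1 - t) * mdist x y.
  by rewrite -{2}c1 cd// distrC ger0_norm; nra.
split=> //.
  move=> C cC Cx Cy; apply: (cC x y _ Cx Cy); first by exists c.
  by exists (t * mdist x y).
(* The triangle on the axis requires distinct points. If [x = y], the dividing point is [x] and the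
   bound is an equality. *)
move=> z; have [xy0|xy0] := eqVneq (mdist x y) 0.
  have yx := mdist_positivity _ _ xy0.
  by rewrite xy0 mulr0 c0 -yx; nra.
have {}xy0 : 0 < mdist x y by rewrite lt_neqAle eq_sym xy0.
have [r tri rE] := comparison_triangle_on_axis x y z xy0.
have [c' gc'] := geo y z; have [c'' gc''] := geo z x.
rewrite -rE ler_pXn2r ?nnegrE ?mdist_ge0 ?sqrtr_ge0//.
apply: (cmp x y z _ _ _ (0, 0) (mdist x y, 0) r (geodesic_path_segment _ _ _ gc)
  (geodesic_path_segment _ _ _ gc') (geodesic_path_segment _ _ _ gc'') tri).
(* [z] is taken as the far end of the side from [y] to [z], with comparison point the apex [r]. *)
- apply: Or32; split.
  + have [_ c'z _] := gc'; exists (mdist y z) => //.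
    by rewrite /= in_itv /= lexx mdist_ge0.
  + exists 1; first by rewrite /= in_itv /= lexx ler01.
    by case: (r) => ? ? /=; congr (_, _); ring.
  + by case: tri.
- apply: Or31; split; first by exists (t * mdist x y).
  + exists t; first by rewrite /= in_itv /= t0 t1.
    by congr (_, _); rewrite /=; ring.
  + rewrite xm /plane_dist /= subrr expr0n addr0 sub0r sqrtr_sqr normrN.
    by rewrite ger0_norm// mulr_ge0.
Qed.

Lemma cat0_midpoint : cat0_space X -> forall x y,
  exists m, (forall C, convex_subset C -> C x -> C y -> C m) /\
    forall z, mdist z m ^+ 2 <=
      (mdist z x ^+ 2 + mdist z y ^+ 2) / 2 - mdist x y ^+ 2 / 4.
Proof.
move=> X0 x y; have [|m [_ _ Cm zm]] := cat0_geodesic_point X0 x y (2^-1).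
  by lra.
by exists m; split=> // z; apply: le_trans (zm z) _; lra.
Qed.

End Cat0Geometry.

(** * Minimizers of uniformly convex functions *)

Section Minimizers.
Context {R : realType} {X : metricType R}.
Implicit Types (x y z p q m : X) (C : set X).
Hypothesis X_complete : complete_metric X.
Hypothesis X_cat0 : cat0_space X.

(* The bounds [r], [s] replace the values [f y], [f z] so that the condition
   passes to upper limits without a limiting argument. *)
Definition midpoint_convex (f : X -> R) : Prop := forall y z m,
  (forall w, mdist w m ^+ 2 <=
      (mdist w y ^+ 2 + mdist w z ^+ 2) / 2 - mdist y z ^+ 2 / 4) ->
  forall r s, f y < r -> f z < s ->
  f m ^+ 2 <= (r ^+ 2 + s ^+ 2) / 2 - mdist y z ^+ 2 / 4.

Lemma dist_midpoint_convex x : midpoint_convex (mdist x).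
Proof.
move=> y z m zm r s yr zs; apply: le_trans (zm x) _.
have y0 := mdist_ge0 x y; have z0 := mdist_ge0 x z.
by rewrite lerB// ler_pM2r// lerD// ler_pXn2r// ?nnegrE; lra.
Qed.

(** The midpoint stays in [C], so its value is at least [r]; midpoint convexity gives
    [r^2 <= (r + e)^2 - d(y, z)^2 / 4]. *)
Lemma almost_minimizers_close C (f : X -> R) (r e : R) y z :
  convex_subset C -> midpoint_convex f -> 0 <= r ->
  (forall w, C w -> r <= f w) -> C y -> C z -> f y < r + e -> f z < r + e ->
  mdist y z ^+ 2 <= 4 * (2 * r * e + e ^+ 2).
Proof.
move=> Cc fc r0 rf Cy Cz ye ze; have [m [Cm mP]] := cat0_midpoint X_cat0 y z.
have := fc _ _ _ mP _ _ ye ze; have := rf _ (Cm _ Cc Cy Cz).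
by nra.
Qed.

Lemma minimizer_unique C (f : X -> R) y z :
  convex_subset C -> midpoint_convex f -> (forall w, 0 <= f w) ->
  C y -> (forall w, C w -> f y <= f w) ->
  C z -> (forall w, C w -> f z <= f w) -> y = z.
Proof.
move=> Cc fc f0 Cy ymin Cz zmin; apply: mdist_positivity.
have zy : f z <= f y by exact: zmin.
have close (e : R) : 0 < e -> mdist y z ^+ 2 <= 4 * (2 * f y * e + e ^+ 2).
  move=> e0; apply: (almost_minimizers_close _ _ _ _ _ _ Cc fc (f0 y) ymin) => //.
    by rewrite ltrDl.
  by rewrite (le_lt_trans zy)// ltrDl.
apply/eqP; rewrite -sqrf_eq0 eq_le sqr_ge0 andbT.
apply/ler_addgt0Pr => e e0; rewrite add0r.
have fy := f0 y.
(* For [t <= 1] the bound [4 * (2 * f y * t + t ^+ 2)] is at most [t * k], hence at most [e] once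
   [t <= e / k]. *)
pose k := 8 * f y + 4; have k0 : 0 < k by rewrite /k; lra.
pose t := Num.min 1 (e / k).
have t0 : 0 < t by rewrite lt_min ltr01 divr_gt0.
have t1 : t <= 1 by rewrite ge_min lexx.
have te : t * k <= e by rewrite -ler_pdivlMr// ge_min lexx orbT.
apply: le_trans (close t t0) _; apply: le_trans te; rewrite /k; nra.
Qed.

(** Near minimizers are close together, so a minimizing sequence is Cauchy; the Lipschitz condition
    shows that its limit attains the infimum. *)
Lemma minimizer_exists C (f : X -> R) :
  C !=set0 -> closed C -> convex_subset C -> midpoint_convex f ->
  (forall w, 0 <= f w) -> (forall y z, f y <= f z + mdist z y) ->
  exists2 c, C c & forall w, C w -> f c <= f w.
Proof.
move=> [c0 Cc0] Ccl Cc fc f0 flip.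
have hinf : has_inf (f @` C).
  by split; [exists (f c0), c0 | exists 0 => _ [w _ <-]].
pose r := inf (f @` C).
have r0 : 0 <= r by apply: lb_le_inf; [case: hinf | move=> _ [w _ <-]].
have rf w : C w -> r <= f w by move=> Cw; apply: ge_inf; [case: hinf | exists w].
have ex n : exists w, C w /\ f w < r + n.+1%:R^-1.
  have [|_ [w Cw <-] fw] := inf_adherent (_ : 0 < n.+1%:R^-1 :> R) hinf => //.
  by exists w.
have [u uP] := choice ex.
have uC n : C (u n) by case: (uP n).
have uf n : f (u n) < r + n.+1%:R^-1 by case: (uP n).
have cau : cauchy (u @ \oo).
  apply: cauchy_exP => e e0.
  pose k := 8 * r + 4; have k0 : 0 < k by rewrite /k; lra.
  pose t := Num.min 1 (e ^+ 2 / 2 / k).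
  have t0 : 0 < t by rewrite lt_min ltr01 !divr_gt0// exprn_gt0.
  have t1 : t <= 1 by rewrite ge_min lexx.
  have te : t * k <= e ^+ 2 / 2 by rewrite -ler_pdivlMr// ge_min lexx orbT.
  have [N _ Nt] := near_infty_natSinv_lt (PosNum t0).
  exists (u N), N => // n Nn; rewrite /= ballEmdist /=.
  have ut k' : (N <= k')%N -> f (u k') < r + t.
    by move=> Nk; apply: lt_trans (uf k') _; rewrite ltrD2l; exact: Nt.
  have := almost_minimizers_close _ _ _ _ _ _ Cc fc r0 rf (uC N) (uC n)
    (ut N (leqnn N)) (ut n Nn).
  move=> d2; rewrite -(ltr_pXn2r (_ : (0 < 2)%N)) ?nnegrE ?mdist_ge0 ?(ltW e0)//.
  apply: le_lt_trans d2 _; apply: (@le_lt_trans _ _ (t * k)).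
    by rewrite /k; nra.
  by apply: le_lt_trans te _; rewrite ltr_pdivrMr//; have := exprn_gt0 2 e0; lra.
have [l ul] := X_complete u cau; exists l.
  by apply: (closed_cvg C Ccl _ l ul); near=> n.
move=> w /rf; apply: le_trans; apply/ler_addgt0Pr => e e0.
have e20 : 0 < e / 2 by lra.
near \oo => n.
have un : mdist l (u n) < e / 2.
  by near: n; exact: metricType_numDomainType.cvgr_dist_lt ul _ e20.
have ne : n.+1%:R^-1 < e / 2.
  by near: n; exact: (near_infty_natSinv_lt (PosNum e20)).
have fun' : f (u n) < r + e / 2 by apply: lt_trans (uf n) _; rewrite ltrD2l.
apply: le_trans (flip l (u n)) _; rewrite (metric_sym (u n)) [e]splitr addrA.
by rewrite lerD// ltW.
Unshelve. all: by end_near. Qed.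

End Minimizers.

(** * Metric projections and best approximation pairs *)

Section Projections.
Context {R : realType} {X : metricType R}.
Implicit Types (x y z p q m a b c : X) (A B C : set X).
Hypothesis X_complete : complete_metric X.
Hypothesis X_cat0 : cat0_space X.

Lemma is_projectionP C x c :
  is_projection C x c <-> C c /\ forall w, C w -> mdist x c <= mdist x w.
Proof.
have lb : has_lbound [set mdist x w | w in C].
  by exists 0 => _ [w _ <-]; exact: mdist_ge0.
split=> -[Cc cP]; split=> //.
  by move=> w Cw; rewrite cP; apply: ge_inf => //; exists w.
apply/eqP; rewrite eq_le; apply/andP; split.
  by apply: lb_le_inf; [exists (mdist x c), c | move=> _ [w Cw <-]; exact: cP].
by apply: ge_inf => //; exists c.
Qed.

Section OneSet.
Variable C : set X.
Hypotheses (C_neq0 : C !=set0) (C_closed : closed C) (C_convex : convex_subset C).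
Local Notation P := (metric_proj C).

(** A nearest point exists, so the default value of [metric_proj] is never reached. *)
Lemma metric_projP x : C (P x) /\ forall w, C w -> mdist x (P x) <= mdist x w.
Proof.
apply/is_projectionP; apply: (@xgetPex _ x [set c | is_projection C x c]).
have [||c Cc cP] := minimizer_exists X_complete X_cat0 C (mdist x)
    C_neq0 C_closed C_convex (dist_midpoint_convex x).
- by move=> w; exact: mdist_ge0.
- by move=> y z; exact: metric_triangle.
- by exists c; apply/is_projectionP.
Qed.

Lemma metric_proj_in x : C (P x). Proof. by case: (metric_projP x). Qed.

Lemma metric_proj_eq x c :
  C c -> (forall w, C w -> mdist x c <= mdist x w) -> P x = c.
Proof.
move=> Cc cmin; have [CP Pmin] := metric_projP x.
apply: (minimizer_unique X_cat0 C (mdist x)) => //.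
- exact: dist_midpoint_convex.
- by move=> w; exact: mdist_ge0.
Qed.

(** The angle at [P x] is not acute: otherwise a short move towards [c], which stays in [C], would
    come closer to [x]. *)
Lemma metric_proj_pythagoras x c :
  C c -> mdist x (P x) ^+ 2 + mdist (P x) c ^+ 2 <= mdist x c ^+ 2.
Proof.
move=> Cc; have [CP Pmin] := metric_projP x.
have xPc := Pmin _ Cc; have xP0 := mdist_ge0 x (P x).
set p := mdist x (P x) in xPc xP0 *; set q := mdist (P x) c.
rewrite leNgt; apply/negP => gap.
have q0 : 0 < q ^+ 2 by nra.
(* Divided by [t], the (CN) inequality bounds the gap [p ^+ 2 + q ^+ 2 - mdist x c ^+ 2] by
   [t * q ^+ 2], which this choice makes half the gap. *)
pose t := (p ^+ 2 + q ^+ 2 - mdist x c ^+ 2) / (2 * q ^+ 2).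
have tE : t * q ^+ 2 = (p ^+ 2 + q ^+ 2 - mdist x c ^+ 2) / 2.
  by rewrite /t; field; rewrite -sqrf_eq0 gt_eqF.
have q20 : 0 < 2 * q ^+ 2 by lra.
have t0 : 0 < t by rewrite divr_gt0// subr_gt0.
have t1 : t <= 1 by rewrite ler_pdivrMr//; nra.
have [|m [_ _ Cm mP]] := cat0_geodesic_point X_cat0 (P x) c t.
  by rewrite (ltW t0).
have pm : p ^+ 2 <= mdist x m ^+ 2.
  by rewrite ler_pXn2r ?nnegrE ?mdist_ge0//; apply: Pmin; exact: Cm.
have := le_trans pm (mP x); rewrite -/p -/q.
have -> : t * (1 - t) * q ^+ 2 = t * (q ^+ 2 - t * q ^+ 2) by ring.
rewrite tE => le; suff : 0 < t * (p ^+ 2 + q ^+ 2 - mdist x c ^+ 2) by nra.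
by rewrite mulr_gt0//; lra.
Qed.

(* With [m] the midpoint of [x] and [P a], the (CN) inequality at [a] and [P x]
   shows that [x], [a], [P a], [P x] nearly form a parallelogram when [P] nearly
   preserves the distance from [x] to [a]. *)
Lemma metric_proj_parallelogram x a :
  mdist (P x) (P a) <= mdist x a /\
  mdist x (P x) ^+ 2 <= mdist a (P a) ^+ 2
    + 2 * (mdist x a ^+ 2 - mdist (P x) (P a) ^+ 2)
    + 6 * (mdist x a + mdist a (P a))
        * Num.sqrt (mdist x a ^+ 2 - mdist (P x) (P a) ^+ 2).
Proof.
have pyx := metric_proj_pythagoras x _ (metric_proj_in a).
have pya := metric_proj_pythagoras a _ (metric_proj_in x).
have [m [_ mP]] := cat0_midpoint X_cat0 x (P a).
have ma := mP a; have mp := mP (P x); have mb := mP (P a).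
have tri := metric_triangle a m (P x).
have tri1 := metric_triangle x a (P a).
have tri2 := metric_triangle a (P a) m.
have tri3 := metric_triangle (P x) (P a) m.
have m0 := mdist_ge0 a m; have n0 := mdist_ge0 (P x) m.
have r0 := mdist_ge0 x a; have D0 := mdist_ge0 a (P a).
have q0 := mdist_ge0 (P x) (P a); have h0 := mdist_ge0 x (P x).
have k0 := mdist_ge0 (P a) m; have l0 := mdist_ge0 x (P a).
have j0 := mdist_ge0 a (P x).
rewrite (metric_sym m) in tri; rewrite (metric_sym (P a) (P x)) in pya.
rewrite mdistxx (metric_sym (P a) x) in mb.
rewrite (metric_sym a x) in ma; rewrite (metric_sym (P x) x) in mp.
move: pyx pya ma mp mb tri tri1 tri2 tri3 m0 n0 r0 D0 q0 h0 k0 l0 j0.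
move: (mdist a m) (mdist (P x) m) (mdist (P a) m) (mdist x (P a)) (mdist a (P x)).
move: (mdist x a) (mdist a (P a)) (mdist (P x) (P a)) (mdist x (P x)).
move=> r D q h u v k l j pyx pya ma mp mb tri tri1 tri2 tri3.
move=> u0 v0 r0 D0 q0 h0 k0 l0 j0.
have juv : j ^+ 2 <= (u + v) ^+ 2 by rewrite ler_pXn2r ?nnegrE//; lra.
(* Parallelogram identity [2 u^2 + 2 v^2 = (u + v)^2 + (u - v)^2]: (CN) at [a] and [P x] bounds the
   left side, and the Pythagorean inequalities bound [l^2] and [j^2 <= (u + v)^2] from below. *)
have uv : (u - v) ^+ 2 <= r ^+ 2 - q ^+ 2 by nra.
have e0 : 0 <= r ^+ 2 - q ^+ 2 by apply: le_trans uv; exact: sqr_ge0.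
have qr : q <= r by rewrite -(ler_pXn2r (_ : (0 < 2)%N)) ?nnegrE//; lra.
split=> //.
have kl : k <= l by rewrite -(ler_pXn2r (_ : (0 < 2)%N)) ?nnegrE//; nra.
have sq : v - u <= Num.sqrt (r ^+ 2 - q ^+ 2).
  apply: le_trans (ler_norm _) _; rewrite -sqrtr_sqr ler_wsqrtr//.
  by rewrite -sqrrN opprB.
have s0 := sqrtr_ge0 (r ^+ 2 - q ^+ 2).
move: (Num.sqrt _) sq s0 => s sq s0.
(* The factor 3 comes from [u <= D + k], [v <= q + k], [q <= r] and [k <= l <= r + D]. *)
have vu : (v - u) * (v + u) <= s * (3 * (r + D)).
  apply: (@le_trans _ _ (s * (v + u))).
    by rewrite ler_wpM2r//; lra.
  by rewrite ler_wpM2l//; lra.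
(* (CN) at [a] with [h^2 + q^2 <= l^2] gives [h^2 <= 2 r^2 + 2 D^2 - q^2 - 4 u^2], while
   [4 u^2 >= D^2 + q^2 - 2 (v^2 - u^2)]. *)
by have := sqr_ge0 (u - v); lra.
Qed.

Lemma metric_proj_nonexpansive x a : mdist (P x) (P a) <= mdist x a.
Proof. by case: (metric_proj_parallelogram x a). Qed.

End OneSet.

Lemma set_dist_le A B a b : A a -> B b -> set_dist A B <= mdist a b.
Proof.
move=> Aa Bb; apply: ge_inf; last by exists a => //; exists b.
by exists 0 => _ [? _ [? _ <-]]; exact: mdist_ge0.
Qed.

Lemma best_pairsC A B a b : best_pairs A B (a, b) -> best_pairs B A (b, a).
Proof.
move=> [/= Aa Bb ab]; split=> //=; rewrite metric_sym ab /set_dist; congr inf.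
by apply/seteqP; split=> _ [u Uu [v Vv <-]]; exists v => //; exists u => //;
  rewrite metric_sym.
Qed.

Lemma best_pairs_proj A B a b : B !=set0 -> closed B -> convex_subset B ->
  best_pairs A B (a, b) -> metric_proj B a = b.
Proof.
move=> B0 Bcl Bc [/= Aa Bb ab]; apply: metric_proj_eq => // w Bw.
by rewrite ab; exact: set_dist_le.
Qed.

(** Projecting to [B] and back fixes both [u] and [a], so the projection to [B] preserves their
    distance exactly; the error terms of the parallelogram bound vanish. *)
Lemma fixed_best_pair A B u :
  A !=set0 -> closed A -> convex_subset A ->
  B !=set0 -> closed B -> convex_subset B -> best_pairs A B !=set0 ->
  metric_proj A (metric_proj B u) = u -> best_pairs A B (u, metric_proj B u).
Proof.
move=> A0 Acl Ac B0 Bcl Bc [[a b] ab] Tu.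
have Pa := best_pairs_proj _ _ _ _ B0 Bcl Bc ab.
have Pb := best_pairs_proj _ _ _ _ A0 Acl Ac (best_pairsC _ _ _ _ ab).
have [Aa Bb abD] := ab; rewrite /= in Aa Bb abD.
have Bu := metric_proj_in _ B0 Bcl Bc u.
have Au : A u by rewrite -Tu; exact: metric_proj_in.
split=> //=; apply/eqP; rewrite eq_le set_dist_le// andbT.
have [le1 +] := metric_proj_parallelogram _ B0 Bcl Bc u a.
have := metric_proj_nonexpansive _ A0 Acl Ac (metric_proj B u) (metric_proj B a).
rewrite Tu Pa Pb abD => le2; rewrite Pa in le1.
have -> : mdist u a = mdist (metric_proj B u) b by apply/eqP; rewrite eq_le le1 le2.
rewrite subrr sqrtr0 !mulr0 !addr0 ler_pXn2r ?nnegrE ?mdist_ge0//.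
by rewrite -abD mdist_ge0.
Qed.

End Projections.

(** * Asymptotic radii and centers of bounded sequences *)

Section AsymptoticCenters.
Context {R : realType} {X : metricType R}.
Implicit Types (x y z m : X) (u : nat -> X).
Hypothesis X_complete : complete_metric X.
Hypothesis X_cat0 : cat0_space X.

Lemma bounded_seqP u : bounded_seq u ->
  forall y, exists M : R, forall n, 0 <= mdist y (u n) <= M.
Proof.
move=> [c [M uM]] y; exists (mdist y c + M) => n; rewrite mdist_ge0 /=.
by apply: le_trans (metric_triangle _ c _) _; rewrite lerD2l.
Qed.

Lemma bounded_seq_comp u (s : nat -> nat) : bounded_seq u -> bounded_seq (u \o s).
Proof. by move=> [c [M uM]]; exists c, M => n; exact: uM. Qed.

Lemma asymptotic_radius_lt u y (r : R) : bounded_seq u ->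
  asymptotic_radius_at u y < r -> \forall n \near \oo, mdist y (u n) < r.
Proof. by move=> /bounded_seqP /(_ y)[M yM]; exact: limn_sup_lt yM. Qed.

Lemma asymptotic_radius_le u y (r : R) : bounded_seq u ->
  (\forall n \near \oo, mdist y (u n) <= r) -> asymptotic_radius_at u y <= r.
Proof. by move=> /bounded_seqP /(_ y)[M yM]; exact: limn_sup_le yM. Qed.

Lemma asymptotic_radius_ge0 u y : bounded_seq u -> 0 <= asymptotic_radius_at u y.
Proof.
move=> bu; rewrite leNgt; apply/negP => /(asymptotic_radius_lt _ _ _ bu) [N _].
by move=> /(_ N (leqnn N)) /=; rewrite ltNge mdist_ge0.
Qed.

Lemma asymptotic_centerP u x : bounded_seq u ->
  asymptotic_center u x <->
  forall y, asymptotic_radius_at u x <= asymptotic_radius_at u y.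
Proof.
move=> bu; have lb : has_lbound (range (asymptotic_radius_at u)).
  by exists 0 => _ [y _ <-]; exact: asymptotic_radius_ge0.
split=> [-> y|xmin]; first by apply: ge_inf => //; exists y.
apply/eqP; rewrite eq_le; apply/andP; split.
  apply: lb_le_inf; first by exists (asymptotic_radius_at u x), x.
  by move=> _ [y _ <-]; exact: xmin.
by apply: ge_inf => //; exists x.
Qed.

Lemma asymptotic_radius_lipschitz u y z : bounded_seq u ->
  asymptotic_radius_at u y <= asymptotic_radius_at u z + mdist z y.
Proof.
move=> bu; apply/ler_addgt0Pr => e e0; apply: asymptotic_radius_le => //.
have := asymptotic_radius_lt u z (asymptotic_radius_at u z + e) bu.
rewrite ltrDl => /(_ e0); apply: filterS => n zn.
apply: le_trans (metric_triangle y z (u n)) _.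
by rewrite (metric_sym y z); lra.
Qed.

(** The distances from [y] and [z] to [u n] are eventually below [r] and [s], so the bound holds for
    each late term and passes to the upper limit. *)
Lemma asymptotic_radius_midpoint_convex u : bounded_seq u ->
  midpoint_convex (asymptotic_radius_at u).
Proof.
move=> bu y z m mP r s yr zs.
have mn : \forall n \near \oo, mdist m (u n) ^+ 2 <=
    (r ^+ 2 + s ^+ 2) / 2 - mdist y z ^+ 2 / 4.
  near=> n; have yn : mdist y (u n) < r.
    by near: n; exact: asymptotic_radius_lt.
  have zn : mdist z (u n) < s by near: n; exact: asymptotic_radius_lt.
  rewrite (metric_sym m); apply: (dist_midpoint_convex (u n)) => //;
    by rewrite metric_sym.
have k0 : 0 <= (r ^+ 2 + s ^+ 2) / 2 - mdist y z ^+ 2 / 4.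
  by have [N _ /(_ N (leqnn N))] := mn; apply: le_trans; exact: sqr_ge0.
rewrite -(sqr_sqrtr k0) ler_pXn2r ?nnegrE ?sqrtr_ge0 ?asymptotic_radius_ge0//.
apply: asymptotic_radius_le => //; apply: filterS mn => n mn.
by rewrite -(ger0_norm (mdist_ge0 m (u n))) -sqrtr_sqr ler_wsqrtr.
Unshelve. all: by end_near. Qed.

Lemma convex_setT : convex_subset [set: X].
Proof. by []. Qed.

Lemma asymptotic_center_exists u : bounded_seq u ->
  exists c, asymptotic_center u c.
Proof.
move=> bu; have [|||c _ cmin] :=
  minimizer_exists X_complete X_cat0 setT (asymptotic_radius_at u) _
    closedT convex_setT (asymptotic_radius_midpoint_convex u bu).
- by exists (u 0%N).
- by move=> w; exact: asymptotic_radius_ge0.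
- by move=> y z; exact: asymptotic_radius_lipschitz.
- by exists c; apply/asymptotic_centerP => // w; exact: cmin.
Qed.

Lemma asymptotic_center_unique u x y : bounded_seq u ->
  asymptotic_center u x -> asymptotic_center u y -> x = y.
Proof.
move=> bu /(asymptotic_centerP _ _ bu) xmin /(asymptotic_centerP _ _ bu) ymin.
apply: (minimizer_unique X_cat0 setT (asymptotic_radius_at u)) => //.
- exact: asymptotic_radius_midpoint_convex.
- by move=> w; exact: asymptotic_radius_ge0.
Qed.

(** At such points the radius is the same for all subsequences, which makes their centers
    comparable. *)
Lemma asymptotic_radius_cvg u y : cvgn (fun n => mdist y (u n)) ->
  forall s : nat -> nat, {homo s : m n / (m < n)%N} ->
  asymptotic_radius_at (u \o s) y = limn (fun n => mdist y (u n)).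
Proof.
move=> cu s sS.
have cs : (fun n => mdist y (u (s n))) @ \oo --> limn (fun n => mdist y (u n)).
  by move=> V /cu; exact: near_strict_mono.
have cvs := cvgP _ cs; rewrite /asymptotic_radius_at (cvg_limn_supE cvs).
by apply: cvg_lim => //; exact: Rhausdorff.
Qed.

Lemma cvg_bounded_seq u y : cvgn (fun n => mdist y (u n)) -> bounded_seq u.
Proof.
move=> /cvg_seq_bounded [M [_ /(_ (M + 1))]].
rewrite ltrDl ltr01 => /(_ isT) uM; exists y, (M + 1) => n.
by apply: le_trans (uM n I); exact: ler_norm.
Qed.

End AsymptoticCenters.

(** * Perturbed alternating projections *)

Section PerturbedAlternatingProjections.
Context {R : realType} {X : metricType R}.
Hypothesis X_complete : complete_metric X.
Hypothesis X_cat0 : cat0_space X.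
Variables A B : set X.
Hypotheses (A_neq0 : A !=set0) (A_closed : closed A) (A_convex : convex_subset A).
Hypotheses (B_neq0 : B !=set0) (B_closed : closed B) (B_convex : convex_subset B).
Hypothesis S_neq0 : best_pairs A B !=set0.
Variables (eps delta : nat -> R) (x y : nat -> X).
Hypotheses (eps_ge0 : forall n, 0 <= eps n) (delta_ge0 : forall n, 0 <= delta n).
Hypotheses (eps_series : cvgn (series eps)) (delta_series : cvgn (series delta)).
Hypothesis y_step : forall n, mdist (y n) (metric_proj B (x n)) <= eps n.
Hypothesis x_step : forall n, mdist (x n.+1) (metric_proj A (y n)) <= delta n.

Local Notation PA := (metric_proj A).
Local Notation PB := (metric_proj B).

Lemma best_pair_PA a b : best_pairs A B (a, b) -> PA b = a.
Proof.
by move=> /best_pairsC; exact: best_pairs_proj.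
Qed.

Lemma best_pair_PB a b : best_pairs A B (a, b) -> PB a = b.
Proof. exact: best_pairs_proj. Qed.

Lemma dist_y_le a b n : best_pairs A B (a, b) ->
  mdist b (y n) <= mdist a (x n) + eps n.
Proof.
move=> ab; apply: le_trans (metric_triangle _ (PB (x n)) _) _.
apply: lerD; last by rewrite metric_sym.
by rewrite -(best_pair_PB _ _ ab); exact: metric_proj_nonexpansive.
Qed.

Lemma dist_xS_le a b n : best_pairs A B (a, b) ->
  mdist a (x n.+1) <= mdist b (y n) + delta n.
Proof.
move=> ab; apply: le_trans (metric_triangle _ (PA (y n)) _) _.
apply: lerD; last by rewrite metric_sym.
by rewrite -{1}(best_pair_PA _ _ ab); exact: metric_proj_nonexpansive.
Qed.

(** Quasi-Fejer monotonicity: one round increases the distance to [a] by at most the summable error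
    [eps n + delta n]. *)
Lemma dist_x_cvg a b : best_pairs A B (a, b) -> cvgn (fun n => mdist a (x n)).
Proof.
move=> ab; apply: (@cvgn_almost_nonincreasing _ _ (eps + delta)).
- by move=> n; exact: mdist_ge0.
- by move=> n; rewrite addr_ge0.
- exact: is_cvg_seriesD.
- move=> n; apply: le_trans (dist_xS_le _ _ n ab) _.
  by rewrite fctE addrA lerD2r; exact: dist_y_le.
Qed.

Lemma eps_cvg0 : eps @ \oo --> 0.
Proof. exact: cvg_series_cvg_0. Qed.

Lemma delta_cvg0 : delta @ \oo --> 0.
Proof. exact: cvg_series_cvg_0. Qed.

Lemma dist_xS_cvg a b : best_pairs A B (a, b) ->
  (fun n => mdist a (x n.+1)) @ \oo --> limn (fun n => mdist a (x n)).
Proof.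
move=> ab; rewrite (cvg_shiftS (fun n => mdist a (x n))).
exact: dist_x_cvg ab.
Qed.

Lemma dist_y_cvg a b : best_pairs A B (a, b) ->
  (fun n => mdist b (y n)) @ \oo --> limn (fun n => mdist a (x n)).
Proof.
move=> ab; set L := limn _.
have lo : (fun n => mdist a (x n.+1) - delta n) @ \oo --> L.
  by rewrite -[L]subr0; apply: cvgB; [exact: dist_xS_cvg ab | exact: delta_cvg0].
have hi : (fun n => mdist a (x n) + eps n) @ \oo --> L.
  by rewrite -[L]addr0; apply: cvgD; [exact: dist_x_cvg ab | exact: eps_cvg0].
apply: squeeze_cvgr lo hi; apply: nearW => n.
by rewrite lerBlDr dist_xS_le//= dist_y_le.
Qed.

(** Supplies the near equality that the parallelogram bound needs at [x n] and [a]. *)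
Lemma dist_PBx_cvg a b : best_pairs A B (a, b) ->
  (fun n => mdist (PB (x n)) b) @ \oo --> limn (fun n => mdist a (x n)).
Proof.
move=> ab; set L := limn _.
have lo : (fun n => mdist b (y n) - eps n) @ \oo --> L.
  by rewrite -[L]subr0; apply: cvgB; [exact: dist_y_cvg ab | exact: eps_cvg0].
have hi : (fun n => mdist a (x n)) @ \oo --> L by exact: dist_x_cvg ab.
apply: squeeze_cvgr lo hi; apply: nearW => n; apply/andP; split.
  rewrite lerBlDr; apply: le_trans (metric_triangle _ (PB (x n)) _) _.
  by rewrite (metric_sym b) lerD2l metric_sym.
by rewrite -(best_pair_PB _ _ ab) (metric_sym a); exact: metric_proj_nonexpansive.
Qed.

Lemma asymptotically_regular :
  (fun n => mdist (PA (PB (x n))) (x n)) @ \oo --> 0.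
Proof.
have [[a b] ab] := S_neq0; have [/= Aa Bb abD] := ab.
set D := set_dist A B in abD.
have D0 : 0 <= D by rewrite -abD mdist_ge0.
have PaE := best_pair_PB _ _ ab.
pose L := limn (fun n => mdist a (x n)).
have rL : (fun n => mdist (x n) a) @ \oo --> L.
  rewrite (_ : (fun n => _) = (fun n => mdist a (x n))); first exact: dist_x_cvg ab.
  by apply/funext => n; rewrite metric_sym.
pose e n := mdist (x n) a ^+ 2 - mdist (PB (x n)) b ^+ 2.
have e_cvg : e @ \oo --> 0.
  rewrite -[0](subrr (L * L)); apply: cvgB; apply: cvgM => //;
    exact: dist_PBx_cvg ab.
have se_cvg : (fun n => Num.sqrt (e n)) @ \oo --> 0.
  rewrite -[0]sqrtr0; apply: continuous_cvg e_cvg; exact: sqrt_continuous.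
(* The parallelogram bound on [mdist (x n) (PB (x n)) ^+ 2], with defect [e n]. *)
pose g n := D ^+ 2 + 2 * e n + 6 * (mdist (x n) a + D) * Num.sqrt (e n).
have g_cvg : g @ \oo --> D ^+ 2.
  rewrite (_ : D ^+ 2 = D ^+ 2 + 2 * 0 + 6 * (L + D) * 0); last by ring.
  apply: cvgD; last apply: cvgM => //.
    by apply: cvgD; [exact: cvg_cst | apply: cvgM => //; exact: cvg_cst].
  by apply: cvgM; [exact: cvg_cst | apply: cvgD => //; exact: cvg_cst].
have hg n : mdist (x n) (PB (x n)) <= Num.sqrt (g n).
  have [_] := metric_proj_parallelogram X_complete X_cat0 _ B_neq0 B_closed
    B_convex (x n) a.
  rewrite PaE abD => /ler_wsqrtr; rewrite sqrtr_sqr ger0_norm//.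
  exact: mdist_ge0.
have sg_cvg : (fun n => Num.sqrt (g n.+1)) @ \oo --> D.
  rewrite (cvg_shiftS (fun n => Num.sqrt (g n))).
  rewrite -[D]ger0_norm// -sqrtr_sqr; apply: continuous_cvg g_cvg.
  exact: sqrt_continuous.
(* [PA (y n)] is a point of [A] near [x n.+1], hence almost at distance [D] from [PB (x n.+1)]; the
   Pythagorean inequality puts it near the projection of that point. The index is shifted because
   [x 0] may be far from [A]. *)
pose k n := delta n + Num.sqrt ((Num.sqrt (g n.+1) + delta n) ^+ 2 - D ^+ 2).
have k_cvg : k @ \oo --> 0.
  rewrite -[0]addr0; apply: cvgD; first exact: delta_cvg0.
  rewrite -[0]sqrtr0; apply: continuous_cvg; first exact: sqrt_continuous.
  rewrite -[0](subrr (D * D)); apply: cvgB; last exact: cvg_cst.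
  by rewrite -[D]addr0; apply: cvgM; apply: cvgD => //; exact: delta_cvg0.
rewrite -(cvg_shiftS (fun n => mdist (PA (PB (x n))) (x n))).
apply: (squeeze_cvgr _ (cvg_cst 0) k_cvg); apply: nearW => n.
rewrite mdist_ge0 /=.
apply: le_trans (metric_triangle _ (PA (y n)) _) _; rewrite addrC lerD//.
  by rewrite metric_sym.
have py := metric_proj_pythagoras X_complete X_cat0 A A_neq0 A_closed A_convex
  (PB (x n.+1)) (PA (y n)) (metric_proj_in X_complete X_cat0 _ A_neq0 A_closed
  A_convex _).
have Dle : D <= mdist (PB (x n.+1)) (PA (PB (x n.+1))).
  by rewrite metric_sym; apply: set_dist_le; exact: metric_proj_in.
have hle : mdist (PB (x n.+1)) (PA (y n)) <= Num.sqrt (g n.+1) + delta n.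
  apply: le_trans (metric_triangle _ (x n.+1) _) _; rewrite lerD//.
  by rewrite metric_sym.
have d0 := mdist_ge0 (PA (PB (x n.+1))) (PA (y n)).
rewrite -(ger0_norm d0) -sqrtr_sqr ler_wsqrtr//.
have h0 := mdist_ge0 (PB (x n.+1)) (PA (y n)).
move: py Dle hle d0 h0; move: (Num.sqrt _) (mdist _ _) (mdist _ _) (mdist _ _).
by move=> s h1 h2 h3; nra.
Qed.

(** By nonexpansiveness and asymptotic regularity, [PA (PB u)] has radius at most that of [u];
    uniqueness of the center makes [u] a fixed point. *)
Lemma center_best_pair (s : nat -> nat) u : {homo s : m n / (m < n)%N} ->
  asymptotic_center (x \o s) u -> best_pairs A B (u, PB u).
Proof.
move=> sS uc; have [[a b] ab] := S_neq0.
have bx : bounded_seq (x \o s).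
  exact: bounded_seq_comp (cvg_bounded_seq _ _ (dist_x_cvg _ _ ab)).
apply: fixed_best_pair => //.
apply: (asymptotic_center_unique X_cat0 _ _ _ bx) => //.
apply/asymptotic_centerP => // w.
have /(asymptotic_centerP _ _ bx) umin := uc.
apply: le_trans (umin w); apply/ler_addgt0Pr => e e0.
have e20 : 0 < e / 2 by lra.
apply: asymptotic_radius_le => //; near=> n.
have un : mdist u (x (s n)) < asymptotic_radius_at (x \o s) u + e / 2.
  by near: n; apply: (asymptotic_radius_lt (x \o s)) => //; rewrite ltrDl.
have Tn : mdist (PA (PB (x (s n)))) (x (s n)) < e / 2.
  near: n; apply: (near_strict_mono s (fun n => mdist (PA (PB (x n))) (x n) < e / 2) sS).
  exact: cvgr_lt asymptotically_regular _ e20.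
apply: le_trans (metric_triangle _ (PA (PB (x (s n)))) _) _.
have : mdist (PA (PB u)) (PA (PB (x (s n)))) <= mdist u (x (s n)).
  by apply: (le_trans (metric_proj_nonexpansive X_complete X_cat0 _ _ _ _ _ _)) => //;
    exact: metric_proj_nonexpansive.
by move=> TT /=; lra.
Unshelve. all: by end_near. Qed.

(** Minimality is expressed by limits along the whole sequence, so that it serves every subsequence
    and transfers to [y], whose distances have the same limits. *)
Lemma best_center_exists : exists2 a, best_pairs A B (a, PB a) &
  forall a' b', best_pairs A B (a', b') ->
    limn (fun n => mdist a (x n)) <= limn (fun n => mdist a' (x n)).
Proof.
have [[a0 b0] ab0] := S_neq0.
have bx := cvg_bounded_seq _ _ (dist_x_cvg _ _ ab0).
have [a ac] := asymptotic_center_exists X_complete X_cat0 _ bx.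
have idS : {homo (@id nat) : m n / (m < n)%N} by [].
have ab := center_best_pair id a idS ac.
exists a => // a' b' ab'.
have /(asymptotic_centerP _ _ bx) /(_ a') := ac.
have rE c d (cd : best_pairs A B (c, d)) : asymptotic_radius_at x c = _ :=
  asymptotic_radius_cvg x c (dist_x_cvg c d cd) id idS.
by rewrite (rE _ _ ab) (rE _ _ ab').
Qed.

(** The center [v] of a subsequence lies in a best pair, so the radii of [a] and [v] are full limits
    and [amin] makes [a] a center too. *)
Lemma best_center_delta_cvg a b : best_pairs A B (a, b) ->
  (forall a' b', best_pairs A B (a', b') ->
    limn (fun n => mdist a (x n)) <= limn (fun n => mdist a' (x n))) ->
  delta_cvg x a.
Proof.
move=> ab amin; have bx := cvg_bounded_seq _ _ (dist_x_cvg _ _ ab).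
split=> // s sS; have bs := bounded_seq_comp _ s bx.
have [v vc] := asymptotic_center_exists X_complete X_cat0 _ bs.
have vb := center_best_pair s v sS vc.
have ac : asymptotic_center (x \o s) a.
  apply/asymptotic_centerP => // w.
  have /(asymptotic_centerP _ _ bs) /(_ w) := vc; apply: le_trans.
  rewrite (asymptotic_radius_cvg _ _ (dist_x_cvg _ _ ab) s sS).
  rewrite (asymptotic_radius_cvg _ _ (dist_x_cvg _ _ vb) s sS).
  exact: amin vb.
by split=> // w wc; exact: asymptotic_center_unique wc ac.
Qed.

(* If the distances [d(a, x_n)] had a limit [L > 0], the points at distance [r]
   from [a] on the geodesics towards [P_A y_n] would cluster at some [c], and
   along a subsequence [d(c, x_n)] would stay below [L - r / 4], although [a] is
   the asymptotic center. *)
Lemma locally_compact_lim0 a b : locally_compact A -> best_pairs A B (a, b) ->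
  delta_cvg x a -> limn (fun n => mdist a (x n)) = 0.
Proof.
move=> Alc ab xa; set L := limn _.
have [/= Aa _ _] := ab.
have cL : (fun n => mdist a (x n)) @ \oo --> L by exact: dist_x_cvg ab.
have L0 : 0 <= L.
  by apply: limr_ge; [exact: dist_x_cvg ab | apply: nearW => n; exact: mdist_ge0].
apply/eqP; rewrite eq_le L0 andbT leNgt; apply/negP => {}L0.
have [V aV [Vc _]] := Alc a Aa.
move: aV; rewrite /within /= => /metricType_numDomainType.nbhs_mdistP [rho /= rho0 rhoV].
(* [rho / 2] keeps points of [A] at distance [r] from [a] inside the compact [V]; [L / 2] makes
   [PA (y n)] eventually at least [r] away from [a]. *)
pose r := Num.min (rho / 2) (L / 2).
have r0 : 0 < r by rewrite lt_min !divr_gt0.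
have rrho : r < rho by rewrite gt_min; apply/orP; left; lra.
have rL : r <= L / 2 by rewrite ge_min lexx orbT.
pose good n := [/\ r <= mdist a (PA (y n)), mdist a (PA (y n)) < L + r / 4 &
  delta n < r / 4].
have near_good : \forall n \near \oo, good n.
  have r80 : 0 < r / 8 by lra.
  near=> n.
  have dn : delta n < r / 8 by near: n; exact: cvgr_lt delta_cvg0 _ r80.
  have xlt : mdist a (x n.+1) < L + r / 8.
    by near: n; apply: cvgr_lt (dist_xS_cvg _ _ ab) _ _; rewrite ltrDl.
  have xgt : L - r / 8 < mdist a (x n.+1).
    by near: n; apply: cvgr_gt (dist_xS_cvg _ _ ab) _ _; rewrite ltrBlDr ltrDl.
  have t1 := metric_triangle a (x n.+1) (PA (y n)).
  have t2 := metric_triangle a (PA (y n)) (x n.+1).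
  have xs := x_step n; rewrite (metric_sym (PA _)) in t2.
  by split; lra.
have ex n : exists z, good n -> [/\ A z, mdist a z = r &
    mdist z (PA (y n)) = mdist a (PA (y n)) - r].
  have [[rd _ _]|ng] := pselect (good n); last by exists a.
  have d0 : 0 < mdist a (PA (y n)) by lra.
  have [|z [az zp Cz _]] := cat0_geodesic_point X_cat0 a (PA (y n))
    (r / mdist a (PA (y n))).
    by rewrite divr_ge0 ?(ltW r0) ?mdist_ge0//= ler_pdivrMr// mul1r.
  exists z => _; split.
  - by apply: Cz => //; exact: metric_proj_in.
  - by rewrite az divfK// gt_eqF.
  - by rewrite zp mulrBl mul1r divfK// gt_eqF.
have [z zP] := choice ex.
have zV : (z @ \oo) V.
  apply: filterS near_good => n /zP [Az az _].
  by apply: rhoV => //=; rewrite az.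
have [c [_ cc]] := Vc (z @ \oo) _ zV.
have r40 : 0 < r / 4 by lra.
have freq N : exists2 n, (N <= n)%N & good n /\ mdist c (z n) < r / 4.
  have FU : (z @ \oo) [set w | exists2 n, (N <= n)%N & good n /\ w = z n].
    apply: filterS (filterI near_good (nbhs_infty_ge N)) => n [gn Nn].
    by exists n.
  have cW : nbhs c [set w | mdist c w < r / 4].
    by apply/metricType_numDomainType.nbhs_mdistP; exists (r / 4).
  have [_ [[n Nn [gn ->]] cz]] := cc _ _ FU cW.
  by exists n.
have [s sS sP] := frequently_subseq _ freq.
(* The iterate close to [PA (y n)] is [x n.+1], hence the successor. *)
have sS' : {homo (succn \o s) : m n / (m < n)%N} by move=> m n /sS.
have [bx /(_ _ sS') [ac _]] := xa.
have bs := bounded_seq_comp _ (succn \o s) bx.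
have /(asymptotic_centerP _ _ bs) /(_ c) := ac.
rewrite (asymptotic_radius_cvg _ _ (dist_x_cvg _ _ ab) _ sS').
apply/negP; rewrite -ltNge -/L; apply: (@le_lt_trans _ _ (L - r / 4)); last by lra.
apply: asymptotic_radius_le => //; apply: nearW => n /=.
have [gn cz] := sP n; have [_ _ zy] := zP _ gn; have [_ yL dr] := gn.
(* Passing through [z (s n)] and [PA (y (s n))] costs at most [r / 4 + (L + r / 4 - r) + r / 4 = L -
   r / 4]. *)
have t1 := metric_triangle c (z (s n)) (x (s n).+1).
have t2 := metric_triangle (z (s n)) (PA (y (s n))) (x (s n).+1).
have xs := x_step (s n); rewrite (metric_sym (x _)) in xs.
by lra.
Unshelve. all: by end_near. Qed.

End PerturbedAlternatingProjections.

(** * Convergence of both sequences *)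

Lemma dist_cvg0 (R : realType) (X : metricType R) (u : nat -> X) a :
  (fun n => mdist a (u n)) @ \oo --> (0 : R) -> u @ \oo --> a.
Proof.
move=> ua; apply/metricType_numDomainType.cvgrPdist_lt => e e0.
exact: cvgr_lt ua _ e0.
Qed.

Theorem corollary4p6 (R : realType) (X : metricType R)
    (X_complete : complete_metric X) (X_cat0 : cat0_space X)
    (A B : set X)
    (A_neq0 : A !=set0) (A_closed : closed A) (A_convex : convex_subset A)
    (B_neq0 : B !=set0) (B_closed : closed B) (B_convex : convex_subset B)
    (S_neq0 : best_pairs A B !=set0)
    (eps delta : nat -> R)
    (eps_ge0 : forall n, 0 <= eps n) (delta_ge0 : forall n, 0 <= delta n)
    (eps_sum : (\sum_(0 <= n <oo) (eps n)%:E < +oo)%E)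
    (delta_sum : (\sum_(0 <= n <oo) (delta n)%:E < +oo)%E)
    (x0 : X) (x y : nat -> X) (x_start : x 0%N = x0)
    (y_step : forall n, mdist (y n) (metric_proj B (x n)) <= eps n)
    (x_step : forall n, mdist (x n.+1) (metric_proj A (y n)) <= delta n) :
  exists a b : X,
    [/\ best_pairs A B (a, b), delta_cvg x a, delta_cvg y b &
        locally_compact A \/ locally_compact B ->
        x @ \oo --> a /\ y @ \oo --> b].
Proof.
have epsC := cvgn_series_lty _ eps_ge0 eps_sum.
have deltaC := cvgn_series_lty _ delta_ge0 delta_sum.
have epsSC := cvgn_series_shift1 _ eps_ge0 epsC.
have epsS_ge0 n : 0 <= eps n.+1 by [].
have yS_step n : mdist (y n.+1) (metric_proj B (x n.+1)) <= eps n.+1 by [].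
have S'_neq0 : best_pairs B A !=set0.
  by have [[a b] ab] := S_neq0; exists (b, a); exact: best_pairsC.
have xcvg a b (ab : best_pairs A B (a, b)) := dist_x_cvg X_complete X_cat0 A B
  A_neq0 A_closed A_convex B_neq0 B_closed B_convex eps delta x y
  eps_ge0 delta_ge0 epsC deltaC y_step x_step a b ab.
have ycvg a b (ab : best_pairs A B (a, b)) := dist_y_cvg X_complete X_cat0 A B
  A_neq0 A_closed A_convex B_neq0 B_closed B_convex eps delta x y
  eps_ge0 delta_ge0 epsC deltaC y_step x_step a b ab.
have ylim a b (ab : best_pairs A B (a, b)) :
    limn (fun n => mdist b (y n)) = limn (fun n => mdist a (x n)).
  by apply: cvg_lim (ycvg _ _ ab); exact: Rhausdorff.
have [a ab amin] := best_center_exists X_complete X_cat0 A B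
  A_neq0 A_closed A_convex B_neq0 B_closed B_convex S_neq0 eps delta x y
  eps_ge0 delta_ge0 epsC deltaC y_step x_step.
set b := metric_proj B a in ab.
have ba := best_pairsC _ _ _ _ ab.
have xa : delta_cvg x a := best_center_delta_cvg X_complete X_cat0 A B
  A_neq0 A_closed A_convex B_neq0 B_closed B_convex S_neq0 eps delta x y
  eps_ge0 delta_ge0 epsC deltaC y_step x_step a b ab amin.
have yb : delta_cvg y b.
  have bmin b' a' : best_pairs B A (b', a') ->
      limn (fun n => mdist b (y n)) <= limn (fun n => mdist b' (y n)).
    by move=> /best_pairsC ab'; rewrite (ylim _ _ ab) (ylim _ _ ab') (amin _ _ ab').
  (* After the exchange a round goes from [y n] to [x n.+1] with error [delta n], then to [y n.+1]
     with error [eps n.+1]. *)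
  exact: (best_center_delta_cvg X_complete X_cat0 B A
    B_neq0 B_closed B_convex A_neq0 A_closed A_convex S'_neq0 delta
    (fun n => eps n.+1) y (fun n => x n.+1) delta_ge0 epsS_ge0 deltaC epsSC
    x_step yS_step b a ba bmin).
exists a, b; split=> // AB.
(* The distances [d(a, x_n)] and [d(b, y_n)] share their limit, so local compactness of either set
   settles both sequences. *)
suff L0 : limn (fun n => mdist a (x n)) = 0.
  by split; apply: dist_cvg0; rewrite -L0; [exact: xcvg ab | exact: ycvg].
case: AB => [Alc|Blc].
  exact: (locally_compact_lim0 X_complete X_cat0 A B
    A_neq0 A_closed A_convex B_neq0 B_closed B_convex eps delta x y
    eps_ge0 delta_ge0 epsC deltaC y_step x_step a b Alc ab xa).
rewrite -(ylim _ _ ab).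
exact: (locally_compact_lim0 X_complete X_cat0 B A
  B_neq0 B_closed B_convex A_neq0 A_closed A_convex delta
  (fun n => eps n.+1) y (fun n => x n.+1) delta_ge0 epsS_ge0 deltaC epsSC
  x_step yS_step b a Blc ba yb).
Qed.
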